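(* Fix an integer $r\ge 1$. Let $Y$ be the pure random simplicial complex on vertex set $[n]$ with each $r$-dimensional simplex included independently at random with probability $p$. Then $p=\dfrac{r!\log n}{n^r}$ is the threshold probability for $Y$ to be connected asymptotically almost surely. That is, if $p=\dfrac{\alpha\log n}{n^r}$ for a constant $\alpha>0$, then as $n\to\infty$: if $\alpha>r!$, then $Y$ is connected with probability tending to $1$; and if $\alpha<r!$, then $Y$ is disconnected with probability tending to $1$.
   Context: The pure random simplicial complex $Y$ has vertex set $[n]=\{1,\dots,n\}$ (all $n$ vertices are always present); each of the $\binom{n}{r+1}$ possible $r$-dimensional simplexes is selected independently with probability $p$, and $Y$ consists of all the vertices, all selected $r$-simplexes and all their faces. *)

(* Defs.v *)
From mathcomp Require Import all_boot all_order all_algebra.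
From mathcomp Require Import classical_sets reals topology normedtype exp.

Set Implicit Arguments.
Unset Strict Implicit.
Unset Printing Implicit Defensive.

Import Order.TTheory GRing.Theory Num.Theory.
Import numFieldNormedType.Exports.

Local Open Scope ring_scope.

Definition rsimplices (n r : nat) : {set {set 'I_n}} :=
  [set s : {set 'I_n} | #|s| == r.+1].

(* The complex spanned by a set S of selected simplexes, as the set of its
   nonempty faces: every vertex is a face whether or not it lies in some
   member of S. *)
Definition spanned_complex (n : nat) (S : {set {set 'I_n}}) : {set {set 'I_n}} :=
  [set f : {set 'I_n} | (#|f| == 1)%N ||
                        ((f != finset.set0) && [exists s in S, f \subset s])].

Definition edge_rel (n : nat) (Y : {set {set 'I_n}}) : rel 'I_n :=
  fun x y => (x != y) && ([set x; y]%SET \in Y).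

Definition connected_complex (n : nat) (Y : {set {set 'I_n}}) : bool :=
  [forall x, forall y, connect (edge_rel Y) x y].

(* The law of the set of selected r-simplexes: the product of Bernoulli(p)
   laws. The formula is meaningful as a probability only for 0 <= p <= 1. *)
Definition selection_weight (R : realType) (n r : nat) (p : R)
    (S : {set {set 'I_n}}) : R :=
  \prod_(s in rsimplices n r) (if s \in S then p else 1 - p).

Definition pure_Pr (R : realType) (n r : nat) (p : R)
    (E : pred {set {set 'I_n}}) : R :=
  \sum_(S : {set {set 'I_n}} | (S \subset rsimplices n r) &&
                               E (spanned_complex S)) selection_weight r p S.

Definition Pr_connected (R : realType) (n r : nat) (p : R) : R :=
  pure_Pr r p (@connected_complex n).

Definition Pr_disconnected (R : realType) (n r : nat) (p : R) : R :=
  pure_Pr r p (fun Y : {set {set 'I_n}} => ~~ connected_complex Y).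

Lemma selection_weight_ge0 (R : realType) (n r : nat) (p : R)
    (S : {set {set 'I_n}}) : 0 <= p <= 1 -> 0 <= selection_weight r p S.
Proof.
case/andP=> p0 p1; apply: prodr_ge0 => s _.
by case: ifP => _ //; rewrite subr_ge0.
Qed.

(* The given simplexes T are all selected with probability p ^ #|T|; this
   determines the law, and T = set0 says that the total mass is 1. *)
Lemma selection_law (R : realType) (n r : nat) (p : R)
    (T : {set {set 'I_n}}) : T \subset rsimplices n r ->
  \sum_(S : {set {set 'I_n}} | (S \subset rsimplices n r) && (T \subset S))
     selection_weight r p S = p ^+ #|T|.
Proof.
move=> TK; set K := rsimplices n r.
pose F s : R := if s \in K then p else 0.
pose G s : R := if s \in T then 0 else if s \in K then 1 - p else 1.
transitivity (\prod_s (F s + G s)).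
  rewrite bigA_distr big_mkcond; apply: eq_bigr => S _.
  case: ifP => [/andP[SK TS]|].
    rewrite /selection_weight big_mkcond; apply: eq_bigr => s _ /=.
    rewrite -/K /F /G; case: (boolP (s \in S)) => sS.
      by rewrite (fintype.subsetP SK).
    by rewrite (contraNF ((fintype.subsetP TS) s)).
  move/negbT; rewrite negb_and => /orP[] /fintype.subsetPn [s s1 s2]; symmetry;
    rewrite (bigD1 s) //=.
    by rewrite s1 /F (negbTE s2) mul0r.
  by rewrite (negbTE s2) /G s1 mul0r.
rewrite -prodr_const [RHS]big_mkcond; apply: eq_bigr => s _ /=.
rewrite /F /G; case: (boolP (s \in T)) => sT.
  by rewrite (fintype.subsetP TK _ sT) addr0.
by case: ifP => _; rewrite ?add0r // addrC subrK.
Qed.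

(* Main.v *)
(* Write L = ln n and beta = alpha / r!.

   If Y is disconnected, some nonempty U with at most n / 2 vertices is crossed
   by no selected simplex; at least |U| C(n - |U|, r) simplexes cross U, so a
   union bound applies. When beta > 1, take a small eps > 0: each U with
   |U| <= eps n contributes at most n ^ (- (1 + d) |U|), where d = (beta - 1) / 2,
   which sums to O(n ^ (- d)), while each of the at most 2 ^ n larger sets
   contributes at most exp (- c L n).

   If beta < 1, Chebyshev's inequality for the number of isolated vertices
   bounds the probability of connectedness by
   1 / (n a) + 1 / (1 - p n ^ (r - 1)) - 1, where a is the probability that a
   given vertex is isolated: two vertices lie together in at most n ^ (r - 1)
   simplexes, so their isolation events are almost independent, and n a is at
   least n ^ ((1 - beta) / 2).

   All error terms are O(1 / L). *)
Require Import Defs.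
From mathcomp Require Import all_boot all_order all_algebra.
From mathcomp Require Import classical_sets reals topology normedtype sequences exp.
From mathcomp Require Import ring lra zify.
Import Order.TTheory GRing.Theory Num.Theory.
Import numFieldNormedType.Exports.
Local Open Scope ring_scope.

(** * Simplexes containing a given set, and simplexes crossing a cut *)

Section Counting.
Variable T : finType.
Implicit Types U W s : {set T}.

(** Adjoining [W] is a bijection from the [k]-subsets of its complement. *)
Lemma card_supersets W k :
  #|[set s : {set T} | (W \subset s) && (#|s| == #|W| + k)%N]|
    = 'C(#|T| - #|W|, k).
Proof.
have <- : #|~: W| = (#|T| - #|W|)%N by rewrite -(cardsC W) addKn.
rewrite -cards_draws.
rewrite -(@card_in_imset _ _ (fun t => W :|: t)
            [set t : {set T} | t \subset ~: W & #|t| == k]); last first.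
  move=> t t'; rewrite !inE => /andP[tW _] /andP[tW' _] /(congr1 (fun s => s :\: W)).
  by rewrite !finset.setDUl finset.setDv !finset.set0U !finset.setDE
    !(finset.setIidPl _).
apply: eq_card => s; apply/idP/idP.
  rewrite inE => /andP[Ws /eqP cs]; apply/imsetP; exists (s :\: W).
    rewrite inE finset.subDset finset.setUCr finset.subsetT /=.
    by rewrite cardsD (finset.setIidPr Ws) cs addKn.
  by rewrite finset.setDE finset.setUIr finset.setUCr finset.setIT (finset.setUidPr Ws).
case/imsetP => t; rewrite !inE => /andP[tW /eqP <-] ->; rewrite finset.subsetUl /=.
rewrite cardsU (_ : W :&: t = finset.set0) ?cards0 ?subn0 //.
by apply/eqP; rewrite finset.setI_eq0 disjoint_sym finset.disjoints_subset.
Qed.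

Definition crossing k U : {set {set T}} :=
  [set s : {set T} | [&& #|s| == k.+1, ~~ [disjoint s & U] & ~~ (s \subset U)]].

(* Only the sets meeting [U] in exactly one point are counted. *)
Lemma card_crossing k U : (0 < k)%N ->
  (#|U| * 'C(#|T| - #|U|, k) <= #|crossing k U|)%N.
Proof.
move=> k0.
have <- : #|~: U| = (#|T| - #|U|)%N by rewrite -(cardsC U) addKn.
rewrite -cards_draws -cardsX.
rewrite -(@card_in_imset _ _ (fun xt : T * {set T} => xt.1 |: xt.2)); last first.
  have UI x (t : {set T}) : x \in U -> t \subset ~: U -> (x |: t) :&: U = [set x] /\ (x |: t) :\: U = t.
    move=> xU tU; split; apply/finset.setP => y; rewrite !inE.
      case: eqP => [->|_] //=; apply/negbTE; rewrite negb_and.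
      by case: (boolP (y \in t)) => //= /(fintype.subsetP tU); rewrite inE.
    case: eqP => [->|_] /=.
      by rewrite xU; apply/esym/negbTE/negP => /(fintype.subsetP tU); rewrite inE xU.
    by rewrite andbC; case: (boolP (y \in t)) => //= /(fintype.subsetP tU); rewrite inE.
  move=> [x t] [y u]; rewrite !inE /= => /and3P[xU tU _] /and3P[yU uU _] e.
  have [e1 e2] := UI _ _ xU tU; have [e3 e4] := UI _ _ yU uU.
  by congr pair; [apply: finset.set1_inj; rewrite -e1 e e3 | rewrite -e2 e e4].
apply/subset_leq_card/fintype.subsetP => _ /imsetP[[x t] /= ] /[!inE] /= /and3P[xU tU /eqP tk] ->.
have xt : x \notin t by apply/negP => /(fintype.subsetP tU); rewrite inE xU.
rewrite cardsU1 xt tk add1n eqxx /=; apply/andP; split.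
  by rewrite -finset.setI_eq0; apply/finset.set0Pn; exists x; rewrite !inE eqxx.
(* Since [k > 0], [t] has a point, and this point lies outside [U]. *)
have /card_gt0P[y yt] : (0 < #|t|)%N by rewrite tk.
apply/fintype.subsetPn; exists y; first by rewrite !inE yt orbT.
by move/(fintype.subsetP tU): yt; rewrite inE.
Qed.

(** This allows a component to be traded for its complement when the latter is smaller. *)
Lemma crossingC k U : crossing k (~: U) = crossing k U.
Proof.
apply/finset.setP => s; rewrite !inE finset.disjoints_subset finset.setCK.
by rewrite finset.disjoints_subset; congr (_ && _); rewrite andbC.
Qed.
End Counting.
Arguments crossing {T} k U.

(** * The law of the selection and the union bound over cuts *)

Section Law.
Variables (R : realType) (n r : nat) (p : R).
Implicit Types S T : {set {set 'I_n}}.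
Local Notation w := (selection_weight r p).
Local Notation K := (rsimplices n r).

(** Independence, by expanding a product of [F s + G s]: [F] weighs selecting [s], [G] omitting it.
    As [F] vanishes on [T] and outside [K], only the wanted [S] survive. *)
Lemma selection_avoid T : T \subset K ->
  \sum_(S : {set {set 'I_n}} | (S \subset K) && [disjoint S & T]) w S
    = (1 - p) ^+ #|T|.
Proof.
move=> TK.
pose F s : R := if s \in K then (if s \in T then 0 else p) else 0.
pose G s : R := if s \in K then 1 - p else 1.
transitivity (\prod_s (F s + G s)).
  rewrite bigA_distr big_mkcond; apply: eq_bigr => S _.
  case: ifP => [/andP[SK TS]|].
    rewrite /selection_weight big_mkcond; apply: eq_bigr => s _ /=.
    rewrite /F /G; case: (boolP (s \in S)) => sS //.
    by rewrite (fintype.subsetP SK) // (disjointFr TS).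
  move/negbT; rewrite negb_and => /orP[/fintype.subsetPn[s s1 s2]|].
    by rewrite (bigD1 s) //= s1 /F (negbTE s2) mul0r.
  rewrite -finset.setI_eq0 => /finset.set0Pn[s] /[!inE] /andP[sS sT].
  by rewrite (bigD1 s) //= sS /F sT if_same mul0r.
rewrite -prodr_const [RHS]big_mkcond; apply: eq_bigr => s _ /=.
rewrite /F /G; case: (boolP (s \in T)) => sT.
  by rewrite (fintype.subsetP TK _ sT) add0r.
by case: ifP => _; rewrite ?add0r // addrC subrK.
Qed.

Lemma selection_total : \sum_(S : {set {set 'I_n}} | S \subset K) w S = 1.
Proof.
have := selection_law (R := R) p (finset.sub0set K); rewrite cards0 expr0 => <-.
by apply: eq_bigl => S; rewrite finset.sub0set andbT.
Qed.

Lemma Pr_connectedE : Pr_connected n r p = 1 - Pr_disconnected n r p.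
Proof.
apply/eqP; rewrite eq_sym subr_eq; apply/eqP.
rewrite -selection_total (bigID (fun S => connected_complex (spanned_complex S))) /=.
by [].
Qed.

Lemma pure_Pr_ge0 (E : pred {set {set 'I_n}}) : 0 <= p <= 1 -> 0 <= pure_Pr r p E.
Proof. by move=> p01; apply: sumr_ge0 => S _; apply: selection_weight_ge0. Qed.

Lemma edge_rel_sym (Y : {set {set 'I_n}}) : symmetric (edge_rel Y).
Proof. by move=> x y; rewrite /edge_rel eq_sym finset.setUC. Qed.

Lemma edge_spanned S s x y : s \in S -> x \in s -> y \in s -> x != y ->
  edge_rel (spanned_complex S) x y.
Proof.
move=> sS xs ys xy; rewrite /edge_rel xy inE; apply/orP; right; apply/andP; split.
  by apply/finset.set0Pn; exists x; rewrite !inE eqxx.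
by apply/existsP; exists s; rewrite sS finset.subUset !finset.sub1set xs ys.
Qed.

(** No selected simplex leaves the component [C] of [x]: one with vertices [u] in [C] and [v]
    outside would contain the edge [uv]. *)
Lemma disconnected_cut S : S \subset K -> ~~ connected_complex (spanned_complex S) ->
  exists U : {set 'I_n}, [&& (0 < #|U|)%N, (#|U|.*2 <= n)%N & [disjoint S & crossing r U]].
Proof.
move=> SK /forallPn[x /forallPn[y nxy]].
pose C := [set z | connect (edge_rel (spanned_complex S)) x z].
have xC : x \in C by rewrite inE connect0.
have yC : y \in ~: C by rewrite !inE.
have dC : [disjoint S & crossing r C].
  rewrite -finset.setI_eq0; apply/negP => /negP /finset.set0Pn[s] /[!inE].
  case/and4P => sS _ + /fintype.subsetPn[v vs].
  rewrite -finset.setI_eq0 => /finset.set0Pn[u] /[!inE] /andP[us xu] /negP; apply.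
  have [<-//|uv] := eqVneq u v.
  by apply: connect_trans xu (connect1 _); apply: edge_spanned vs uv.
have sC := cardsC C; rewrite card_ord in sC.
have C0 : (0 < #|C|)%N by apply/card_gt0P; exists x.
have C1 : (0 < #|~: C|)%N by apply/card_gt0P; exists y.
(* The smaller of [C] and its complement is the required set. *)
have [h|h] := leqP #|C|.*2 n; [exists C|exists (~: C)]; rewrite ?crossingC dC andbT ?C0 ?C1 ?h //=.
by move: sC h; move: #|C| #|~: C| => a b; lia.
Qed.

Hypotheses (r0 : (0 < r)%N) (p01 : 0 <= p <= 1).

Lemma crossing_sub (U : {set 'I_n}) : crossing r U \subset K.
Proof. by apply/fintype.subsetP => s; rewrite !inE => /and3P[]. Qed.

Lemma Pr_disconnected_le :
  Pr_disconnected n r p <=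
    \sum_(U : {set 'I_n} | (0 < #|U|)%N && (#|U|.*2 <= n)%N)
      (1 - p) ^+ (#|U| * 'C(n - #|U|, r)).
Proof.
have w0 S : 0 <= w S by apply: selection_weight_ge0.
have [q0 q1] : 0 <= 1 - p /\ 1 - p <= 1 by case/andP: p01; split; lra.
apply: (@le_trans _ _ (\sum_(U : {set 'I_n} | (0 < #|U|)%N && (#|U|.*2 <= n)%N)
   \sum_(S : {set {set 'I_n}} | (S \subset K) && [disjoint S & crossing r U]) w S)); last first.
  apply: ler_sum => U _; rewrite selection_avoid ?crossing_sub //.
  by apply: ler_wiXn2l => //; have := card_crossing _ r U r0; rewrite card_ord.
rewrite /Pr_disconnected /pure_Pr big_mkcondr /=.
under [leRHS]eq_bigr => U _ do rewrite big_mkcondr.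
(* After the exchange, a disconnected [S] is paid for by the single cut it provides. *)
rewrite exchange_big; apply: ler_sum => S SK; case: ifP => [dS|_]; last first.
  by apply: sumr_ge0 => U _; case: ifP.
have [U /and3P[U0 U1 U2]] := disconnected_cut _ SK dS.
rewrite (bigD1 U) ?U0 //= U2 lerDl.
by apply: sumr_ge0 => V _; case: ifP.
Qed.
End Law.

(** * Falling factorials, binomials and Bernoulli's inequality *)

Lemma ffact_le_exp n m : (n ^_ m <= n ^ m)%N.
Proof.
elim: m => [|m IHm]; first by rewrite ffactn0.
by rewrite ffactnSr expnSr leq_mul // leq_subr.
Qed.

(** Each factor [n - i] of the falling factorial has [i < m <= k]. *)
Lemma exp_le_ffact n m k : (m <= k)%N -> ((n - k) ^ m <= n ^_ m)%N.
Proof.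
elim: m => [|m IHm] mk; first by rewrite ffactn0.
by rewrite ffactnSr expnSr leq_mul ?IHm ?leq_sub2l // ltnW.
Qed.

Lemma bin_le_exp n m : ('C(n, m) <= n ^ m)%N.
Proof.
by apply: leq_trans (ffact_le_exp n m); rewrite -bin_ffact leq_pmulr ?fact_gt0.
Qed.

Lemma ler_1subMn_exp (R : realDomainType) (p : R) k : 0 <= p <= 1 ->
  1 - p * k%:R <= (1 - p) ^+ k.
Proof.
move=> /andP[p0 p1]; elim: k => [|k IHk]; first by rewrite mulr0 subr0.
rewrite exprS -[k.+1%:R]natr1.
have k0 : 0 <= k%:R :> R by [].
have /(ler_wpM2l _) := IHk; have q0 : 0 <= 1 - p by lra.
move=> /(_ _ q0); apply: le_trans.
(* This is the excess of [(1 - p) * (1 - p * k)] over [1 - p * (k + 1)]. *)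
have : 0 <= p * p * k%:R by rewrite !mulr_ge0.
by nra.
Qed.

(** * Second moment method for isolated vertices *)

Section Isolated.
Variables (R : realType) (n r : nat) (p : R).
Implicit Types S T : {set {set 'I_n}}.
Local Notation w := (selection_weight r p).
Local Notation K := (rsimplices n r).

Definition star (v : 'I_n) : {set {set 'I_n}} := [set s in K | v \in s].

Lemma star_sub v : star v \subset K.
Proof. by apply/fintype.subsetP => s; rewrite !inE => /andP[]. Qed.

Lemma card_star v : #|star v| = 'C(n.-1, r).
Proof.
have := card_supersets _ [set v] r; rewrite card_ord cards1 subn1 => <-.
by apply: eq_card => s; rewrite !inE finset.sub1set andbC add1n.
Qed.

(** The other [r - 1] vertices determine such a simplex. This small overlap makes the isolation
    events nearly independent. *)
Lemma card_starI u v : (0 < r)%N -> u != v ->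
  (#|star u :&: star v| <= n ^ r.-1)%N.
Proof.
move=> r0 uv; have := card_supersets _ [set u; v] r.-1.
rewrite card_ord cards2 uv => e.
apply: (@leq_trans 'C(n - 2, r.-1)); last first.
  apply: leq_trans (bin_le_exp _ _) _.
  by case: (r.-1) => // k; rewrite leq_exp2r // leq_subr.
rewrite -e; apply/subset_leq_card/fintype.subsetP => s; rewrite !inE.
rewrite finset.subUset !finset.sub1set => /andP[/andP[/eqP -> ->] /andP[_ ->]] /=.
by rewrite !addSn add0n prednK.
Qed.

Lemma isolated_disconnected S v : (1 < n)%N -> [disjoint S & star v] -> S \subset K ->
  ~~ connected_complex (spanned_complex S).
Proof.
move=> n1 dS SK; apply/forallPn; exists v; apply/forallPn.
have [u uv] : exists u, u != v.
  have /card_gt0P[u] : (0 < #|[set~ v]|)%N by rewrite cardsC1 card_ord; lia.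
  by rewrite !inE => h; exists u.
exists u; apply/negP => /connectP[[|y q] /= ]; first by move=> _ e; rewrite e eqxx in uv.
case/andP => + _ _; rewrite /edge_rel inE => /andP[vy].
(* The edge has two vertices, so it is a face because of a selected simplex, not as a bare
   vertex. *)
rewrite cards2 vy /= => /andP[_ /existsP[s /andP[sS]]].
rewrite finset.subUset !finset.sub1set => /andP[vs _].
suff : s \in star v by rewrite (disjointFr dS).
by rewrite inE vs (fintype.subsetP SK).
Qed.

(** [X] counts isolated vertices; [a] is the probability that a given vertex is isolated. *)
Let X S : R := \sum_(v < n) [disjoint S & star v]%:R.
Let a : R := (1 - p) ^+ 'C(n.-1, r).

Lemma isolated_first_moment : \sum_(S : {set {set 'I_n}} | S \subset K) w S * X S = n%:R * a.
Proof.
under eq_bigr => S _ do rewrite mulr_sumr.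
rewrite exchange_big /=.
rewrite (eq_bigr (fun=> a)) ?sumr_const ?card_ord ?mulr_natl // => v _.
rewrite /a -(card_star v) -(selection_avoid _ _ r) ?star_sub // big_mkcondr.
by apply: eq_bigr => S _; case: ifP; rewrite ?mulr1 ?mulr0.
Qed.

Lemma isolated_second_moment :
  \sum_(S : {set {set 'I_n}} | S \subset K) w S * X S ^+ 2 =
  \sum_(u < n) \sum_(v < n) (1 - p) ^+ #|star u :|: star v|.
Proof.
under eq_bigr => S _.
  rewrite expr2 /X big_distrlr /= mulr_sumr.
  under eq_bigr do rewrite mulr_sumr.
  over.
rewrite exchange_big /=; apply: eq_bigr => u _.
rewrite exchange_big /=; apply: eq_bigr => v _.
rewrite -(selection_avoid _ _ r) ?finset.subUset ?star_sub // big_mkcondr.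
apply: eq_bigr => S _.
have -> : [disjoint S & star u :|: star v] = [disjoint S & star u] && [disjoint S & star v].
  by rewrite !(disjoint_sym S) !finset.disjoints_subset finset.subUset.
by do 2!case: [disjoint S & _]; rewrite /= ?mulr1 ?mulr0.
Qed.

Hypotheses (r0 : (0 < r)%N) (p0 : 0 <= p) (p1 : p < 1) (n1 : (1 < n)%N).
Hypothesis (pm : p * (n ^ r.-1)%:R < 1).

(** Chebyshev's inequality: connectedness forces [X = 0], where [(X / mu - 1) ^ 2] is 1, so its
    probability is at most the expectation of this square. *)
Lemma Pr_connected_le :
  Pr_connected n r p <= (n%:R * a)^-1 + (1 - p * (n ^ r.-1)%:R)^-1 - 1.
Proof.
set m := (n ^ r.-1)%N; set mu := n%:R * a.
have p01 : 0 <= p <= 1 by rewrite p0 ltW.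
have w0 S : 0 <= w S by apply: selection_weight_ge0.
have q0 : 0 < 1 - p by rewrite subr_gt0.
have a0 : 0 < a by rewrite exprn_gt0.
have n0 : 0 < n%:R :> R by rewrite ltr0n ltnW.
have mu0 : 0 < mu by rewrite mulr_gt0.
have pm0 : 0 < 1 - p * m%:R by rewrite subr_gt0.
have Xm : \sum_(S : {set {set 'I_n}} | S \subset K) w S * X S ^+ 2 <= mu + mu ^+ 2 / (1 - p * m%:R).
  rewrite isolated_second_moment.
  (* For [u != v], inclusion-exclusion on the stars and Bernoulli's inequality give the second
     summand. Keeping it on the diagonal too makes the total exactly [mu + mu ^ 2 / (1 - p * m)]. *)
  apply: (@le_trans _ _ (\sum_(u < n) \sum_(v < n)
      ((if u == v then a else 0) + a ^+ 2 / (1 - p * m%:R)))).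
    apply: ler_sum => u _; apply: ler_sum => v _; case: eqVneq => [<-|uv].
      rewrite finset.setUid card_star lerDl divr_ge0 ?exprn_ge0 //; exact: ltW.
    rewrite add0r ler_pdivlMr //.
    have -> : a ^+ 2 = (1 - p) ^+ #|star u :|: star v| * (1 - p) ^+ #|star u :&: star v|.
      by rewrite -exprD cardsUI !card_star exprD.
    apply: ler_wpM2l; first by rewrite exprn_ge0 // ltW.
    apply: le_trans (ler_1subMn_exp _ _ _ p01); rewrite lerD2l lerN2.
    by apply: ler_wpM2l => //; rewrite ler_nat card_starI.
  under eq_bigr => u _ do rewrite big_split /= -big_mkcond (big_pred1 u) ?sumr_const //.
  rewrite !sumr_const card_ord -[_ / _ *+ n]mulr_natl -[leLHS]mulr_natl mulrDr /mu.
  by rewrite exprMn expr2 !mulrA.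
have c0 : Pr_connected n r p <= \sum_(S : {set {set 'I_n}} | S \subset K) w S * (X S / mu - 1) ^+ 2.
  rewrite /Pr_connected /pure_Pr big_mkcondr /=; apply: ler_sum => S SK.
  case: ifP => [cS|_]; last by rewrite mulr_ge0 // sqr_ge0.
  rewrite /X big1 ?mul0r ?sub0r ?sqrrN ?expr1n ?mulr1 // => v _.
  case: (boolP [disjoint S & star v]) => // dS.
  by have := isolated_disconnected S v n1 dS SK; rewrite cS.
apply: (le_trans c0).
(* The cross term contributes -2 and the total mass 1. *)
have -> : \sum_(S : {set {set 'I_n}} | S \subset K) w S * (X S / mu - 1) ^+ 2 =
    (\sum_(S : {set {set 'I_n}} | S \subset K) w S * X S ^+ 2) / mu ^+ 2 - 1.
  transitivity (\sum_(S : {set {set 'I_n}} | S \subset K)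
    (w S * X S ^+ 2 / mu ^+ 2 - 2 / mu * (w S * X S) + w S)).
    by apply: eq_bigr => S _; field; rewrite lt0r_neq0.
  rewrite big_split /= sumrB -mulr_suml -mulr_sumr.
  rewrite isolated_first_moment selection_total -/mu.
  by rewrite divfK ?lt0r_neq0 //; ring.
rewrite lerD2r ler_pdivrMr ?exprn_gt0 //.
apply: le_trans Xm _; rewrite le_eqVlt; apply/orP; left; apply/eqP; field.
by rewrite !lt0r_neq0.
Qed.
End Isolated.

Local Open Scope classical_set_scope.

(** * Asymptotic estimates at p = alpha ln n / n^r *)

Section Estimates.
Variable R : realType.
Implicit Types (x y z p q L c : R).

Lemma near_ln_ge c : \forall n \near \oo, c <= ln n%:R.
Proof.
near=> n; rewrite -[leLHS]expRK ler_ln ?posrE ?expR_gt0 //.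
  by near: n; apply: nbhs_infty_ger.
by rewrite ltr0n; near: n; apply: nbhs_infty_gt.
Unshelve. all: by end_near. Qed.

Lemma cvg1_of_ln_bound (f : nat -> R) c :
  (\forall n \near \oo, 1 - c / ln n%:R <= f n <= 1) -> f n @[n --> \oo] --> (1 : R).
Proof.
move=> fc; apply/cvgrPdist_le => e e0; near=> n.
(* The sign of [c] is unknown, hence the absolute value; the added 1 keeps [ln n] positive. *)
have L1 : `|c| / e + 1 <= ln n%:R by near: n; apply: near_ln_ge.
have /andP[f1 f2] : 1 - c / ln n%:R <= f n <= 1 by near: n.
have L0 : 0 < ln n%:R :> R.
  by apply: lt_le_trans L1; rewrite ltr_wpDl // divr_ge0 // ltW.
rewrite ger0_norm ?subr_ge0 //; apply: (@le_trans _ _ (c / ln n%:R)); first lra.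
rewrite ler_pdivrMr // mulrC -ler_pdivrMr //; apply: le_trans L1.
apply: ler_wpDr => //; apply: ler_wpM2r; first by rewrite invr_ge0 ltW.
exact: ler_norm.
Unshelve. all: by end_near. Qed.

(** Weakens each negative power of [n] to an error of order [1 / ln n]. *)
Lemma expRN_le_inv x : 0 < x -> expR (- x) <= x^-1.
Proof.
move=> x0; rewrite expRN lef_pV2 ?posrE ?expR_gt0 //.
by apply: le_trans (expR_ge1Dx x); lra.
Qed.

(** Square [x / 2 <= expR (x / 2)]. At [x = ln n] it yields [ln n / n <= 4 / ln n]. *)
Lemma sqr_le_expR x : 0 <= x -> x * x <= 4 * expR x.
Proof.
move=> x0; have := expR_ge1Dx (x / 2).
have -> : expR x = expR (x / 2) * expR (x / 2) by rewrite -expRD -splitr.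
move: (expR (x / 2)) => y h.
have : (x / 2) * (x / 2) <= y * y by apply: ler_pM; lra.
lra.
Qed.

Lemma exprn_1sub_le p k : p <= 1 -> (1 - p) ^+ k <= expR (- (p * k%:R)).
Proof.
move=> p1; rewrite -mulNr expRM_natr; apply: lerXn2r; rewrite ?nnegrE.
- by rewrite subr_ge0.
- exact: expR_ge0.
- exact: expR_ge1Dx.
Qed.

(** The inverse of [1 - p] is [1 + p / (1 - p)], at most [expR (p / (1 - p))]. *)
Lemma expR_le_exprn_1sub p k : p < 1 -> expR (- (p * k%:R / (1 - p))) <= (1 - p) ^+ k.
Proof.
move=> p1; have q0 : 0 < 1 - p by rewrite subr_gt0.
have -> : - (p * k%:R / (1 - p)) = - (p / (1 - p)) * k%:R by ring.
rewrite expRM_natr; apply: lerXn2r; rewrite ?nnegrE ?expR_ge0 ?(ltW q0) //.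
rewrite expRN -[leRHS]invrK lef_pV2 ?posrE ?expR_gt0 ?invr_gt0 //.
apply: le_trans (expR_ge1Dx _); rewrite le_eqVlt; apply/orP; left; apply/eqP.
by field; rewrite lt0r_neq0.
Qed.

Lemma expR_sub1_le z : 0 <= z -> z <= 1 / 2 -> expR z - 1 <= 2 * z.
Proof.
move=> z0 z1; have := expR_ge1Dx (- z); rewrite expRN => h.
have e0 := expR_gt0 z; have : (1 - z) * expR z <= 1 by rewrite -ler_pdivlMr // div1r.
by nra.
Qed.

Lemma sum_exp_card n q : \sum_(U : {set 'I_n}) q ^+ #|U| = (1 + q) ^+ n.
Proof.
transitivity (\prod_(i < n) (q + 1)); last by rewrite prodr_const card_ord addrC.
rewrite bigA_distr; apply: eq_bigr => U _.
by rewrite -big_mkcond prodr_const.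
Qed.

(** [q ^+ #|U|] will bound small cuts and [y ^+ n] large ones; adding them avoids splitting the sum
    by size. The -1 removes the empty set from the binomial expansion of [(1 + q) ^+ n]. *)
Lemma sum_nonempty_le n q y : 0 <= q -> 0 <= y ->
  \sum_(U : {set 'I_n} | (0 < #|U|)%N) (q ^+ #|U| + y ^+ n)
    <= expR (q * n%:R) - 1 + (2 * y) ^+ n.
Proof.
move=> q0 y0; rewrite big_split /=; apply: lerD.
  rewrite lerBrDr; apply: (@le_trans _ _ ((1 + q) ^+ n)).
    rewrite -sum_exp_card [leRHS](bigD1 finset.set0) //= cards0 expr0 [leRHS]addrC lerD2r.
    by rewrite le_eqVlt; apply/orP; left; apply/eqP/eq_bigl => U; rewrite card_gt0.
  rewrite expRM_natr; apply: lerXn2r; rewrite ?nnegrE ?expR_ge0 ?addr_ge0 //.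
  exact: expR_ge1Dx.
rewrite sumr_const -[leLHS]mulr_natl exprMn; apply: ler_wpM2r; first exact: exprn_ge0.
rewrite -natrX ler_nat.
apply: leq_trans (max_card _) _.
by rewrite -cardsT -powersetT card_powerset cardsT card_ord.
Qed.

Variables (r : nat) (alpha : R).
Hypotheses (r0 : (0 < r)%N) (alpha0 : 0 < alpha).
(** The ratio to the threshold: a vertex lies in about [beta * ln n] selected simplexes on
    average. *)
Let beta : R := alpha / r`!%:R.
Let P n : R := alpha * ln n%:R / n%:R ^+ r.

Let fact0 : 0 < r`!%:R :> R. Proof. by rewrite ltr0n fact_gt0. Qed.
Let beta0 : 0 < beta. Proof. by rewrite divr_gt0. Qed.

(** [r! * C(m, r)] is a falling factorial, at least [(m - r) ^ r], hence at least [(c * n) ^ r]. *)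
Lemma P_bin_ge n m c : (0 < n)%N -> 0 <= c -> c * n%:R <= (m - r)%:R ->
  beta * ln n%:R * c ^+ r <= P n * 'C(m, r)%:R.
Proof.
move=> n0 c0 cm; have x0 : 0 < n%:R :> R by rewrite ltr0n.
have L0 : 0 <= ln n%:R :> R by apply: ln_ge0; rewrite ler1n.
have h : c ^+ r <= r`!%:R * 'C(m, r)%:R / n%:R ^+ r.
  rewrite ler_pdivlMr ?exprn_gt0 // -exprMn -natrM mulnC bin_ffact.
  apply: le_trans (_ : (m - r)%:R ^+ r <= _).
    by apply: lerXn2r; rewrite ?nnegrE // mulr_ge0 // ltW.
  by rewrite -natrX ler_nat exp_le_ffact.
have /(ler_wpM2l _) := h; move=> /(_ (beta * ln n%:R)); rewrite mulr_ge0 ?(ltW beta0) //.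
move=> /(_ isT) /le_trans; apply.
rewrite le_eqVlt; apply/orP; left; apply/eqP; rewrite /beta /P; field.
by rewrite !lt0r_neq0 ?exprn_gt0.
Qed.

Lemma P_bin_le n m : (0 < n)%N -> (m <= n)%N -> P n * 'C(m, r)%:R <= beta * ln n%:R.
Proof.
move=> n0 mn; have x0 : 0 < n%:R :> R by rewrite ltr0n.
have L0 : 0 <= ln n%:R :> R by apply: ln_ge0; rewrite ler1n.
have h : r`!%:R * 'C(m, r)%:R / n%:R ^+ r <= 1 :> R.
  rewrite ler_pdivrMr ?exprn_gt0 // mul1r -natrM mulnC bin_ffact -natrX ler_nat.
  by apply: leq_trans (ffact_le_exp _ _) _; rewrite leq_exp2r.
have /(ler_wpM2l _) := h; move=> /(_ (beta * ln n%:R)); rewrite mulr_ge0 ?(ltW beta0) //.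
move=> /(_ isT); rewrite mulr1; apply: le_trans.
rewrite le_eqVlt; apply/orP; left; apply/eqP; rewrite /beta /P; field.
by rewrite !lt0r_neq0 ?exprn_gt0.
Qed.

Lemma P_ge0 n : (0 < n)%N -> 0 <= P n.
Proof.
move=> n0; rewrite /P divr_ge0 ?exprn_ge0 ?mulr_ge0 ?(ltW alpha0) //.
by apply: ln_ge0; rewrite ler1n.
Qed.

Lemma P_mul_le n : (0 < n)%N -> 0 < ln n%:R :> R ->
  P n * (n ^ r.-1)%:R <= 4 * alpha / ln n%:R.
Proof.
move=> n0 L0; have x0 : 0 < n%:R :> R by rewrite ltr0n.
rewrite natrX /P -[in n%:R ^+ r](prednK r0) exprS.
have -> : alpha * ln n%:R / (n%:R * n%:R ^+ r.-1) * n%:R ^+ r.-1 = alpha * ln n%:R / n%:R.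
  by field; rewrite !lt0r_neq0 // exprn_gt0.
rewrite ler_pdivrMr // mulrAC ler_pdivlMr // mulrAC -[_ * _ * n%:R]mulrA mulrCA.
rewrite -mulrA ler_pM2l // .
by have := @sqr_le_expR _ (ltW L0); rewrite lnK ?posrE.
Qed.

Lemma P_le n : (0 < n)%N -> 0 < ln n%:R :> R -> P n <= 4 * alpha / ln n%:R.
Proof.
move=> n0 L0; apply: le_trans (P_mul_le _ n0 L0); rewrite ler_peMr ?P_ge0 //.
by rewrite ler1n expn_gt0 n0.
Qed.

Lemma Pr_connected_ln_bound : beta < 1 ->
  \forall n \near \oo, Pr_connected n r (P n) <= (2 / (1 - beta) + 8 * alpha) / ln n%:R.
Proof.
(* So [beta = 1 - 2 * d]: one [d] absorbs the division by [1 - P n], the other gives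
   [n * a >= n ^ d]. *)
move=> b1; pose d := (1 - beta) / 2.
have d0 : 0 < d by rewrite /d; lra.
have d1 : d < 1 / 2 by rewrite /d; have := beta0; lra.
near=> n.
have L1 : 4 * alpha / d + 1 <= ln n%:R by near: n; apply: near_ln_ge.
have n1 : (1 < n)%N by near: n; apply: nbhs_infty_gt.
have n0 : (0 < n)%N by apply: ltnW.
set L := ln n%:R in L1 *.
have D1 : 0 < 4 * alpha / d by rewrite divr_gt0 // mulr_gt0.
have L0 : 0 < L by lra.
have aL : 4 * alpha / L <= d.
  by rewrite ler_pdivrMr // [d * L]mulrC -ler_pdivrMr //; lra.
have pd : P n <= d by apply: le_trans (P_le n n0 L0) aL.
have md : P n * (n ^ r.-1)%:R <= d by apply: le_trans (P_mul_le n n0 L0) aL.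
have p0 := P_ge0 n n0.
have p1 : P n < 1 by lra.
have m1 : P n * (n ^ r.-1)%:R < 1 by lra.
apply: (le_trans (Pr_connected_le _ _ _ _ r0 p0 p1 n1 m1)).
have L'0 : 0 < L^-1 by rewrite invr_gt0.
have -> : (2 / (1 - beta) + 8 * alpha) / L = (d * L)^-1 + 2 * (4 * alpha / L).
  by rewrite /d; field; rewrite !lt0r_neq0 // subr_gt0.
rewrite -addrA; apply: lerD.
  have x0 : 0 < n%:R :> R by rewrite ltr0n.
  apply: le_trans (expRN_le_inv _ (mulr_gt0 d0 L0)).
  rewrite expRN lef_pV2 ?posrE ?expR_gt0 ?mulr_gt0 ?exprn_gt0 ?subr_gt0 //.
  have -> : n%:R = expR L :> R by rewrite lnK ?posrE.
  apply: (@le_trans _ _ (expR L * expR (- (P n * 'C(n.-1, r)%:R / (1 - P n))))).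
    rewrite -expRD ler_expR.
    suff : P n * 'C(n.-1, r)%:R / (1 - P n) <= (1 - d) * L by lra.
    rewrite ler_pdivrMr ?subr_gt0 //.
    apply: le_trans (P_bin_le n n.-1 n0 (leq_pred n)) _; rewrite -/L [leRHS]mulrAC.
    apply: ler_wpM2r; first exact: ltW.
    have -> : beta = 1 - 2 * d by rewrite /d; field.
    have : 0 <= d * P n by rewrite mulr_ge0 // ltW.
    lra.
  by apply: ler_wpM2l; [exact: expR_ge0 | exact: expR_le_exprn_1sub].
apply: le_trans (_ : 2 * (P n * (n ^ r.-1)%:R) <= _); last first.
  by apply: ler_wpM2l => //; apply: P_mul_le.
have y0 : 0 <= P n * (n ^ r.-1)%:R by rewrite mulr_ge0.
move: md m1 y0; move: (P n * _) => y yd y1 y0.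
rewrite lerBlDr -[leLHS]div1r ler_pdivrMr ?subr_gt0 //.
(* Equivalent to [1 / (1 - y) <= 1 + 2 * y], valid as [y <= d < 1 / 2]. *)
have : 0 <= y * (1 - 2 * y) by rewrite mulr_ge0 //; lra.
by nra.
Unshelve. all: by end_near. Qed.

Lemma Pr_disconnected_ln_bound : 1 < beta ->
  exists c, \forall n \near \oo, (0 <= P n <= 1) && (Pr_disconnected n r (P n) <= c / ln n%:R).
Proof.
have Pge := P_bin_ge; have b0 := beta0; clearbody beta.
move=> b1; pose t := beta - 1; pose d := t / 2.
(* Chosen so that [beta * (1 - 2 * e * r) = 1 + d], a lower bound for [beta * (1 - 2 * e) ^ r] by
   Bernoulli. *)
pose e := t / (4 * r%:R * beta).
pose c1 := beta * e * (1 / 4) ^+ r.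
have R0 : 1 <= r%:R :> R by rewrite ler1n.
have t0 : 0 < t by rewrite subr_gt0.
have d0 : 0 < d by rewrite divr_gt0.
have re : e * (4 * r%:R * beta) = t.
  by rewrite /e divfK // lt0r_neq0 // !mulr_gt0 ?b0 ?ltr0n.
have e0 : 0 < e by rewrite divr_gt0 // !mulr_gt0 ?b0 ?ltr0n.
have e1 : e <= 1 / 4.
  rewrite /e ler_pdivrMr ?mulr_gt0 ?b0 ?ltr0n //.
  have : beta * 1 <= beta * r%:R by apply: ler_wpM2l => //; lra.
  rewrite /t; lra.
have c10 : 0 < c1 by rewrite mulr_gt0 ?exprn_gt0 ?divr_gt0 // mulr_gt0.
exists (2 / d + 2 / c1); near=> n.
(* The terms ensure in turn [P n <= 1], [d * L >= 2] and [c1 * L >= 2]. *)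
have L1 : 4 * alpha + 2 / d + 2 / c1 + 1 <= ln n%:R by near: n; apply: near_ln_ge.
have n0 : (0 < n)%N by near: n; apply: nbhs_infty_gt.
have n4 : 4 * r%:R <= n%:R :> R by near: n; apply: nbhs_infty_ger.
have nr : r%:R / e <= n%:R :> R by near: n; apply: nbhs_infty_ger.
have {}nr : r%:R <= e * n%:R :> R by rewrite mulrC -ler_pdivrMr.
have x0 : 0 < n%:R :> R by rewrite ltr0n.
set L := ln n%:R in L1 *.
have [D1 D2] : 0 < 2 / d /\ 0 < 2 / c1 by rewrite !divr_gt0.
have L0 : 0 < L by have := alpha0; lra.
have p0 := P_ge0 n n0.
have p1 : P n <= 1.
  by apply: le_trans (P_le n n0 L0) _; rewrite -/L ler_pdivrMr // mul1r; lra.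
rewrite p0 p1 /=.
(* These are [n ^ (- (1 + d))] and [n ^ (- c1)]. *)
pose q := expR (- ((1 + d) * L)); pose y := expR (- (c1 * L)).
have q0 : 0 <= q by apply: expR_ge0.
have y0 : 0 <= y by apply: expR_ge0.
have p01 : 0 <= P n <= 1 by rewrite p0 p1.
apply: le_trans (Pr_disconnected_le _ _ _ _ r0 p01) _.
apply: (@le_trans _ _ (\sum_(U : {set 'I_n} | (0 < #|U|)%N) (q ^+ #|U| + y ^+ n))).
  rewrite big_mkcondr; apply: ler_sum => U U0; case: ifP => U2; last first.
    by rewrite addr_ge0 ?exprn_ge0.
  move: U0 U2; move: #|U| => k k0 k2.
  apply: le_trans (exprn_1sub_le _ _ p1) _.
  have rk : n%:R - k%:R - r%:R <= (n - k - r)%:R :> R.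
    have : (n <= k + (r + (n - k - r)))%N by rewrite -!leq_subLR.
    by rewrite -(ler_nat R) !natrD addrA -lerBlDl opprD addrA.
  have k1 : 2 * k%:R <= n%:R :> R by move: k2; rewrite -mul2n -(ler_nat R) natrM.
  have K0 : 0 < k%:R :> R by rewrite ltr0n.
  have [ke|ke] := leP k%:R (e * n%:R).
    apply: ler_wpDr; first exact: exprn_ge0.
    rewrite /q -expRM_natr ler_expR mulNr lerN2 natrM [k%:R * _]mulrC mulrA.
    apply: ler_wpM2r; first exact: ltW.
    have [h0 h1] : 0 <= 1 - 2 * e /\ 2 * e <= 1 by split; lra.
    (* Both [k] and [r] are at most [e * n]. *)
    have h2 : (1 - 2 * e) * n%:R <= (n - k - r)%:R by lra.
    apply: le_trans (Pge n _ _ n0 h0 h2); rewrite -/L [leRHS]mulrAC.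
    apply: ler_wpM2r; first exact: ltW.
    have h3 : 0 <= 2 * e <= 1 by apply/andP; split; lra.
    have := ler_1subMn_exp _ (2 * e) r h3.
    move/(ler_wpM2l (ltW b0)); apply: le_trans.
    rewrite /d; move: re; rewrite /t; lra.
  apply: ler_wpDl; first exact: exprn_ge0.
  rewrite /y -expRM_natr ler_expR mulNr lerN2 natrM [leRHS]mulrCA.
  have h0 : 0 <= 1 / 4 :> R by lra.
  (* Here [k <= n / 2] and [r <= n / 4]. *)
  have h2 : (1 / 4) * n%:R <= (n - k - r)%:R :> R by lra.
  have h := Pge n _ _ n0 h0 h2.
  apply: le_trans (_ : (e * n%:R) * (beta * L * (1 / 4) ^+ r) <= _).
    by rewrite le_eqVlt; apply/orP; left; apply/eqP; rewrite /c1; ring.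
  have e_n0 : 0 <= e * n%:R by rewrite mulr_ge0 // ltW.
  have bL0 : 0 <= beta * L * (1 / 4) ^+ r.
    by rewrite mulr_ge0 ?exprn_ge0 // mulr_ge0 // ltW.
  exact: ler_pM e_n0 bL0 (ltW ke) h.
apply: le_trans (sum_nonempty_le _ _ _ q0 y0) _.
rewrite [leRHS]mulrDl; apply: lerD.
  (* [q * n = n ^ (- d)] is at most 1/2, so [expR (q * n) - 1] is at most twice it. *)
  have -> : q * n%:R = expR (- (d * L)).
    rewrite -[n%:R]lnK ?posrE // -/L /q -expRD; congr expR; ring.
  have z : expR (- (d * L)) <= (d * L)^-1 by apply: expRN_le_inv; rewrite mulr_gt0.
  have z2 : (d * L)^-1 <= 1 / 2.
    have L2 : 2 <= d * L by rewrite [leRHS]mulrC -ler_pdivrMr //; have := alpha0; lra.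
    by rewrite div1r lef_pV2 ?posrE // (lt_le_trans _ L2).
  apply: le_trans (expR_sub1_le _ (expR_ge0 _) (le_trans z z2)) _.
  by rewrite -[leRHS]mulrA ler_pM2l // -invfM.
have z : y <= (c1 * L)^-1 by apply: expRN_le_inv; rewrite mulr_gt0.
have z2 : (c1 * L)^-1 <= 1 / 2.
  have L2 : 2 <= c1 * L by rewrite [leRHS]mulrC -ler_pdivrMr //; have := alpha0; lra.
  by rewrite div1r lef_pV2 ?posrE // (lt_le_trans _ L2).
apply: (@le_trans _ _ (2 * y)); last by rewrite -[leRHS]mulrA ler_pM2l // -invfM.
(* Since [2 * y <= 1] and [n >= 1], the power is at most [2 * y]. *)
rewrite -[leRHS]expr1; apply: ler_wiXn2l => //; first by rewrite mulr_ge0.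
lra.
Unshelve. all: by end_near. Qed.
End Estimates.

(** * The two sides of the threshold *)

Theorem corollary5p7 (R : realType) (r : nat) (hr : (1 <= r)%N)
    (alpha : R) (halpha : 0 < alpha) :
  (r`!%:R < alpha ->
     Pr_connected n r (alpha * ln n%:R / n%:R ^+ r) @[n --> \oo] --> (1 : R)) /\
  (alpha < r`!%:R ->
     Pr_disconnected n r (alpha * ln n%:R / n%:R ^+ r) @[n --> \oo] --> (1 : R)).
Proof.
have fact0 : 0 < r`!%:R :> R by rewrite ltr0n fact_gt0.
split=> h.
  have b1 : 1 < alpha / r`!%:R by rewrite ltr_pdivlMr // mul1r.
  have [c hc] := Pr_disconnected_ln_bound _ _ _ hr halpha b1.
  apply: (@cvg1_of_ln_bound _ _ c); near=> n.
  have /andP[p01 ub] : (0 <= alpha * ln n%:R / n%:R ^+ r <= 1) &&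
    (Pr_disconnected n r (alpha * ln n%:R / n%:R ^+ r) <= c / ln n%:R) by near: n.
  have := @pure_Pr_ge0 R n r _ (fun Y => ~~ connected_complex Y) p01.
  rewrite Pr_connectedE -/(Pr_disconnected _ _ _) => lb.
  by apply/andP; split; lra.
have b1 : alpha / r`!%:R < 1 by rewrite ltr_pdivrMr // mul1r.
apply: (@cvg1_of_ln_bound _ _ (2 / (1 - alpha / r`!%:R) + 8 * alpha)); near=> n.
have ub : Pr_connected n r (alpha * ln n%:R / n%:R ^+ r) <=
    (2 / (1 - alpha / r`!%:R) + 8 * alpha) / ln n%:R.
  by near: n; apply: Pr_connected_ln_bound.
have n0 : (0 < n)%N by near: n; apply: nbhs_infty_gt.
(* Forces [p <= 1], so that the probability of connectedness is nonnegative. *)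
have L1 : 4 * alpha + 1 <= ln n%:R by near: n; apply: near_ln_ge.
have L0 : 0 < ln n%:R :> R by lra.
have p01 : 0 <= alpha * ln n%:R / n%:R ^+ r <= 1.
  rewrite P_ge0 //= (le_trans (P_le _ _ _ hr halpha n n0 L0)) //.
  by rewrite ler_pdivrMr // mul1r; lra.
have := @pure_Pr_ge0 R n r _ (fun Y => connected_complex Y) p01.
move: ub; rewrite -/(Pr_connected _ _ _) Pr_connectedE => ub lb.
by apply/andP; split; lra.
Unshelve. all: by end_near. Qed.
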